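(* Let $\mathcal{A}\in\mathbb{R}^{I\times J\times K}$, let the positive integer $R$ be an upper bound of $\mathrm{rank}(\mathcal{A})$, let $\lambda>0$ and $s>1$, and let $\bm{\omega}^n=(\mathbf{X}^n,\mathbf{Y}^n,\mathbf{Z}^n,\bm{\alpha}^n)$, $n\in\mathbb{N}$, be a sequence generated by the LRAT algorithm with parameters $R,\lambda,s$. Then there exist four positive scalars $L_1,L_2,L_3,L_4$ such that for every integer $n\geq 1$ the following hold: there is some $\bm{\eta}_1^n\in\partial_{\mathbf{X}}\Psi(\bm{\omega}^{n})$ such that $\|\bm{\eta}_1^n\|_F\leq L_1\|\bm{\omega}^{n}-\bm{\omega}^{n-1}\|_F$; there is some $\bm{\eta}_2^n\in\partial_{\mathbf{Y}}\Psi(\bm{\omega}^{n})$ such that $\|\bm{\eta}_2^n\|_F\leq L_2\|\bm{\omega}^{n}-\bm{\omega}^{n-1}\|_F$; there is some $\bm{\eta}_3^n\in\partial_{\mathbf{Z}}\Psi(\bm{\omega}^{n})$ such that $\|\bm{\eta}_3^n\|_F\leq L_3\|\bm{\omega}^{n}-\bm{\omega}^{n-1}\|_F$; there is some $\bm{\eta}_4^n\in\partial_{\bm{\alpha}}\Psi(\bm{\omega}^{n})$ such that $\|\bm{\eta}_4^n\|_F\leq L_4\|\bm{\omega}^{n}-\bm{\omega}^{n-1}\|_F$.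
   Context: Notation. For $\mathbf{X}=(\mathbf{x}_1,\dots,\mathbf{x}_R)\in\mathbb{R}^{I\times R}$, $\mathbf{Y}=(\mathbf{y}_1,\dots,\mathbf{y}_R)\in\mathbb{R}^{J\times R}$, $\mathbf{Z}=(\mathbf{z}_1,\dots,\mathbf{z}_R)\in\mathbb{R}^{K\times R}$ and a row vector $\bm{\alpha}=(\alpha_1,\dots,\alpha_R)\in\mathbb{R}^R$, set $[\bm{\alpha};\mathbf{X},\mathbf{Y},\mathbf{Z}]_R=\sum_{r=1}^R\alpha_r\,\mathbf{x}_r\circ\mathbf{y}_r\circ\mathbf{z}_r$, where $\mathbf{x}\circ\mathbf{y}\circ\mathbf{z}$ is the tensor with entries $x_iy_jz_k$. The rank of $\mathcal{A}$ is the minimal number of such outer products summing to $\mathcal{A}$. $\|\cdot\|_F$ is the Frobenius norm (Euclidean norm for vectors; for tuples $\bm{\omega}$ the square root of the sum of squares of all entries), $\|\bm{\alpha}\|_1=\sum_r|\alpha_r|$. Let $S_1,S_2,S_3$ be the sets of matrices in $\mathbb{R}^{I\times R},\mathbb{R}^{J\times R},\mathbb{R}^{K\times R}$, respectively, all of whose columns have Euclidean norm one, and $\delta_S$ the indicator function ($0$ on $S$, $+\infty$ off $S$). Put $f(\mathbf{X},\mathbf{Y},\mathbf{Z},\bm{\alpha})=\frac12\|\mathcal{A}-[\bm{\alpha};\mathbf{X},\mathbf{Y},\mathbf{Z}]_R\|_F^2$, $g(\bm{\alpha})=\lambda\|\bm{\alpha}\|_1$ and, for $\bm{\omega}=(\mathbf{X},\mathbf{Y},\mathbf{Z},\bm{\alpha})$,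 $$\Psi(\bm{\omega})=f(\mathbf{X},\mathbf{Y},\mathbf{Z},\bm{\alpha})+g(\bm{\alpha})+\delta_{S_1}(\mathbf{X})+\delta_{S_2}(\mathbf{Y})+\delta_{S_3}(\mathbf{Z}).$$ Subdifferentials. For a proper lower semicontinuous $h:\mathbb{R}^m\to(-\infty,+\infty]$ and $x\in\mathrm{dom}\,h$, the Fréchet subdifferential $\hat\partial h(x)$ is the set of $u$ with $\liminf_{y\to x,\,y\neq x}\frac{h(y)-h(x)-\langle u,y-x\rangle}{\|y-x\|}\geq0$, and the (limiting) subdifferential $\partial h(x)$ is the set of $u$ for which there are $x_k\to x$ with $h(x_k)\to h(x)$ and $u_k\in\hat\partial h(x_k)$ with $u_k\to u$. $\partial_{\mathbf{X}}\Psi(\bm{\omega})$ denotes the subdifferential at $\mathbf{X}$ of $\Psi$ as a function of $\mathbf{X}$ alone with the other blocks fixed; similarly $\partial_{\mathbf{Y}},\partial_{\mathbf{Z}},\partial_{\bm{\alpha}}$. The Khatri-Rao product is $\mathbf{X}\odot\mathbf{Y}=(\mathbf{x}_1\otimes\mathbf{y}_1,\dots,\mathbf{x}_R\otimes\mathbf{y}_R)$ with $\otimes$ the Kronecker product. With $\mathbf{D}_{\bm\alpha}=\mathrm{diag}(\alpha_1,\dots,\alpha_R)$, put $\mathbf{U}=\mathbf{D}_{\bm\alpha}(\mathbf{Z}\odot\mathbf{Y})^T$, $\mathbf{V}=\mathbf{D}_{\bm\alpha}(\mathbf{Z}\odot\mathbf{X})^T$, $\mathbf{W}=\mathbf{D}_{\bm\alpha}(\mathbf{Y}\odot\mathbf{X})^T$,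 and let $\mathbf{Q}\in\mathbb{R}^{R\times IJK}$ be the matrix whose $r$-th row is the vectorization of $\mathbf{x}_r\circ\mathbf{y}_r\circ\mathbf{z}_r$. LRAT algorithm. Input: $\mathcal{A}$, $R$ (upper bound of $\mathrm{rank}(\mathcal{A})$), $\lambda$, $s>1$. Start from $(\mathbf{X}^0,\mathbf{Y}^0,\mathbf{Z}^0,\bm{\alpha}^0)$ with $\mathbf{X}^0\in S_1$, $\mathbf{Y}^0\in S_2$, $\mathbf{Z}^0\in S_3$. For $n=0,1,2,\dots$: (1) $\mathbf{U}^n$ is $\mathbf{U}$ computed from $(\bm{\alpha}^n,\mathbf{Y}^n,\mathbf{Z}^n)$, $d_n=\max\{\|\mathbf{U}^n{\mathbf{U}^n}^T\|_F,1\}$, $\mathbf{D}^n=\mathbf{X}^n-\frac{1}{sd_n}\nabla_{\mathbf{X}}f(\mathbf{X}^n,\mathbf{Y}^n,\mathbf{Z}^n,\bm{\alpha}^n)$, and $\mathbf{X}^{n+1}$ is obtained from $\mathbf{D}^n$ by dividing each column by its Euclidean norm. (2) $\mathbf{V}^n$ is $\mathbf{V}$ computed from $(\bm{\alpha}^n,\mathbf{X}^{n+1},\mathbf{Z}^n)$, $e_n=\max\{\|\mathbf{V}^n{\mathbf{V}^n}^T\|_F,1\}$, $\mathbf{E}^n=\mathbf{Y}^n-\frac{1}{se_n}\nabla_{\mathbf{Y}}f(\mathbf{X}^{n+1},\mathbf{Y}^n,\mathbf{Z}^n,\bm{\alpha}^n)$, and $\mathbf{Y}^{n+1}$ is obtained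 from $\mathbf{E}^n$ by dividing each column by its norm. (3) $\mathbf{W}^n$ is $\mathbf{W}$ computed from $(\bm{\alpha}^n,\mathbf{X}^{n+1},\mathbf{Y}^{n+1})$, $f_n=\max\{\|\mathbf{W}^n{\mathbf{W}^n}^T\|_F,1\}$, $\mathbf{F}^n=\mathbf{Z}^n-\frac{1}{sf_n}\nabla_{\mathbf{Z}}f(\mathbf{X}^{n+1},\mathbf{Y}^{n+1},\mathbf{Z}^n,\bm{\alpha}^n)$, and $\mathbf{Z}^{n+1}$ is obtained from $\mathbf{F}^n$ by dividing each column by its norm. (4) $\mathbf{Q}^{n+1}$ is $\mathbf{Q}$ computed from $(\mathbf{X}^{n+1},\mathbf{Y}^{n+1},\mathbf{Z}^{n+1})$, $\eta_n=\max\{\|\mathbf{Q}^{n+1}{\mathbf{Q}^{n+1}}^T\|_F,1\}$, $\bm{\beta}^{n+1}=\bm{\alpha}^n-\frac{1}{s\eta_n}\nabla_{\bm{\alpha}}f(\mathbf{X}^{n+1},\mathbf{Y}^{n+1},\mathbf{Z}^{n+1},\bm{\alpha}^n)$, and $\bm{\alpha}^{n+1}=\mathcal{S}_{\lambda/(s\eta_n)}(\bm{\beta}^{n+1})$, where $\mathcal{S}_\tau$ is componentwise soft thresholding, $\mathcal{S}_\tau(t)=\mathrm{sgn}(t)\max\{|t|-\tau,0\}$. A sequence generated by the algorithm is understood to be one for which all columns of $\mathbf{D}^n,\mathbf{E}^n,\mathbf{F}^n$ are nonzero, so that the normalizations are defined. *)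

(* Defs.v *)
From HB Require Import structures.
From mathcomp Require Import all_boot all_order all_algebra.
From mathcomp Require Import all_classical all_reals all_analysis.
From mathcomp Require Import mxtens.

Set Implicit Arguments.
Unset Strict Implicit.
Unset Printing Implicit Defensive.
Import Order.TTheory GRing.Theory Num.Theory.
Import numFieldNormedType.Exports.

Local Open Scope classical_set_scope.
Local Open Scope ring_scope.

(* The norm carried by 'M[R]_(m, n) in the library is the sup norm; it induces
   the same topology as the Frobenius norm below. *)
Definition inner_mx (R : realType) (m n : nat) (A B : 'M[R]_(m, n)) : R :=
  \sum_(i < m) \sum_(j < n) A i j * B i j.

Definition norm_F (R : realType) (m n : nat) (A : 'M[R]_(m, n)) : R :=
  Num.sqrt (\sum_(i < m) \sum_(j < n) A i j ^+ 2).

Notation tensor R I J K := {ffun 'I_I * 'I_J * 'I_K -> R}.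

Definition tnorm_F (R : realType) (I J K : nat) (A : tensor R I J K) : R :=
  Num.sqrt (\sum_e A e ^+ 2).

Definition outer (R : realType) (I J K : nat)
    (x : 'cV[R]_I) (y : 'cV[R]_J) (z : 'cV[R]_K) : tensor R I J K :=
  [ffun e => x e.1.1 0 * y e.1.2 0 * z e.2 0].

Definition cp_sum (R : realType) (I J K p : nat) (a : 'rV[R]_p)
    (X : 'M[R]_(I, p)) (Y : 'M[R]_(J, p)) (Z : 'M[R]_(K, p)) : tensor R I J K :=
  \sum_(l < p) a 0 l *: outer (col l X) (col l Y) (col l Z).

Definition has_cp_length (R : realType) (I J K : nat) (A : tensor R I J K)
    (n : nat) : Prop :=
  exists (X : 'M[R]_(I, n)) (Y : 'M[R]_(J, n)) (Z : 'M[R]_(K, n)),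
    A = \sum_(l < n) outer (col l X) (col l Y) (col l Z).

Lemma has_cp_length_ex (R : realType) (I J K : nat) (A : tensor R I J K) :
  exists n, `[< has_cp_length A n >].
Proof.
pose T : finType := ('I_I * 'I_J * 'I_K)%type.
pose v (l : 'I_#|T|) : T := enum_val l.
exists #|T|; apply/asboolP.
exists (\matrix_(i, l) (A (v l) * (i == (v l).1.1)%:R)).
exists (\matrix_(j, l) (j == (v l).1.2)%:R), (\matrix_(k, l) (k == (v l).2)%:R).
apply/ffunP => -[[i j] k]; rewrite sum_ffunE.
rewrite (bigD1 (enum_rank ((i, j, k) : T))) //= big1 => [|l neq].
  by rewrite !ffunE !mxE /v enum_rankK /= !eqxx !mulr1 addr0.
rewrite !ffunE !mxE /=.
have : v l != (i, j, k) by apply: contraNneq neq => <-; rewrite /v enum_valK.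
case: (v l) => -[i' j'] k' /=; rewrite !xpair_eqE !negb_and.
by rewrite ![_ == i']eq_sym ![_ == j']eq_sym ![_ == k']eq_sym
  => /orP[/orP[]|] /negbTE ->; rewrite !(mulr0, mul0r).
Qed.

Definition tensor_rank (R : realType) (I J K : nat) (A : tensor R I J K) : nat :=
  ex_minn (has_cp_length_ex A).

Definition unit_cols (R : realType) (m p : nat) : set 'M[R]_(m, p) :=
  [set X | forall l, norm_F (col l X) = 1].

Definition delta_ (R : realType) (T : Type) (S : set T) (x : T) : \bar R :=
  if x \in S then 0%E else +oo%E.

Definition norm1 (R : realType) (p : nat) (a : 'rV[R]_p) : R :=
  \sum_(l < p) `|a 0 l|.

Definition fidelity (R : realType) (I J K p : nat) (A : tensor R I J K)
    (X : 'M[R]_(I, p)) (Y : 'M[R]_(J, p)) (Z : 'M[R]_(K, p)) (a : 'rV[R]_p) : R :=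
  2^-1 * tnorm_F (A - cp_sum a X Y Z) ^+ 2.

Notation blocks R I J K p :=
  ('M[R]_(I, p) * 'M[R]_(J, p) * 'M[R]_(K, p) * 'rV[R]_p)%type.

Definition norm_blocks (R : realType) (I J K p : nat)
    (w : blocks R I J K p) : R :=
  let: (X, Y, Z, a) := w in
  Num.sqrt (norm_F X ^+ 2 + norm_F Y ^+ 2 + norm_F Z ^+ 2 + norm_F a ^+ 2).

Definition Psi (R : realType) (I J K p : nat) (A : tensor R I J K) (lambda : R)
    (w : blocks R I J K p) : \bar R :=
  let: (X, Y, Z, a) := w in
  ((fidelity A X Y Z a)%:E + (lambda * norm1 a)%:E
   + delta_ R (@unit_cols R I p) X + delta_ R (@unit_cols R J p) Y
   + delta_ R (@unit_cols R K p) Z)%E.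

Definition frechet_subdiff (R : realType) (m n : nat)
    (h : 'M[R]_(m, n) -> \bar R) (x : 'M[R]_(m, n)) : set 'M[R]_(m, n) :=
  [set u | h x \is a fin_num /\
    (0 <= limf_einf (fun y => (h y - h x - (inner_mx u (y - x))%:E)
                              * ((norm_F (y - x))^-1)%:E) x^')%E].

Definition limiting_subdiff (R : realType) (m n : nat)
    (h : 'M[R]_(m, n) -> \bar R) (x : 'M[R]_(m, n)) : set 'M[R]_(m, n) :=
  [set u | h x \is a fin_num /\
    exists (x_ u_ : nat -> 'M[R]_(m, n)),
      [/\ x_ @ \oo --> x, h (x_ k) @[k --> \oo] --> h x,
          (forall k, frechet_subdiff h (x_ k) (u_ k)) & u_ @ \oo --> u]].

Section PartialSubdifferentials.
Variables (R : realType) (I J K p : nat).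
Implicit Types (h : blocks R I J K p -> \bar R) (w : blocks R I J K p).

Definition subdiff_X h w : set 'M[R]_(I, p) :=
  let: (X, Y, Z, a) := w in limiting_subdiff (fun X' => h (X', Y, Z, a)) X.

Definition subdiff_Y h w : set 'M[R]_(J, p) :=
  let: (X, Y, Z, a) := w in limiting_subdiff (fun Y' => h (X, Y', Z, a)) Y.

Definition subdiff_Z h w : set 'M[R]_(K, p) :=
  let: (X, Y, Z, a) := w in limiting_subdiff (fun Z' => h (X, Y, Z', a)) Z.

Definition subdiff_alpha h w : set 'rV[R]_p :=
  let: (X, Y, Z, a) := w in limiting_subdiff (fun a' => h (X, Y, Z, a')) a.

End PartialSubdifferentials.

Definition grad (R : realType) (m n : nat) (F : 'M[R]_(m, n) -> R)
    (X : 'M[R]_(m, n)) : 'M[R]_(m, n) :=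
  \matrix_(i, j) 'D_(delta_mx i j) (F : 'M[R]_(m, n) -> R^o) X.

(* [*t] is the Kronecker product; the product of two columns has type
   'M_(m * n, 1 * 1), and 1 * 1 reduces to 1. *)
Definition khatri_rao (R : realType) (m n p : nat)
    (X : 'M[R]_(m, p)) (Y : 'M[R]_(n, p)) : 'M[R]_(m * n, p) :=
  \matrix_(i, l) (col l X *t col l Y) i 0.

(* The order of the entries is immaterial: Q is only used through Q Q^T. *)
Definition vec_tensor (R : realType) (I J K : nat) (A : tensor R I J K) :
    'rV[R]_(I * J * K) :=
  \row_e A (mxtens_unindex (mxtens_unindex e).1, (mxtens_unindex e).2).

(* U, V and W are mat_kr a Z Y, mat_kr a Z X and mat_kr a Y X. *)
Definition mat_kr (R : realType) (m n p : nat) (a : 'rV[R]_p)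
    (B : 'M[R]_(m, p)) (C : 'M[R]_(n, p)) : 'M[R]_(p, m * n) :=
  diag_mx a *m (khatri_rao B C)^T.

Definition mat_Q (R : realType) (I J K p : nat)
    (X : 'M[R]_(I, p)) (Y : 'M[R]_(J, p)) (Z : 'M[R]_(K, p)) :
    'M[R]_(p, I * J * K) :=
  \matrix_(l < p) vec_tensor (outer (col l X) (col l Y) (col l Z)).

Definition step_const (R : realType) (m n : nat) (M : 'M[R]_(m, n)) : R :=
  Num.max (norm_F (M *m M^T)) 1.

Definition normalize_cols (R : realType) (m p : nat) (D : 'M[R]_(m, p)) :
    'M[R]_(m, p) :=
  \matrix_(i, l) (D i l / norm_F (col l D)).

Definition soft_threshold (R : realType) (p : nat) (tau : R) (b : 'rV[R]_p) :
    'rV[R]_p :=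
  \row_l (Num.sg (b 0 l) * Num.max (`|b 0 l| - tau) 0).

Definition LRAT_step (R : realType) (I J K p : nat) (A : tensor R I J K)
    (lambda s : R) (w w' : blocks R I J K p) : Prop :=
  let: (X, Y, Z, a) := w in
  let: (X', Y', Z', a') := w' in
  let d := step_const (mat_kr a Z Y) in
  let D := X - (s * d)^-1 *: grad (fun M => fidelity A M Y Z a) X in
  let e := step_const (mat_kr a Z X') in
  let E := Y - (s * e)^-1 *: grad (fun M => fidelity A X' M Z a) Y in
  let f := step_const (mat_kr a Y' X') in
  let F := Z - (s * f)^-1 *: grad (fun M => fidelity A X' Y' M a) Z in
  let eta := step_const (mat_Q X' Y' Z') in
  let b := a - (s * eta)^-1 *: grad (fun c => fidelity A X' Y' Z' c) a in
  [/\ (forall l, col l D != 0) /\ X' = normalize_cols D,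
      (forall l, col l E != 0) /\ Y' = normalize_cols E,
      (forall l, col l F != 0) /\ Z' = normalize_cols F
    & a' = soft_threshold (lambda / (s * eta)) b].

Definition LRAT_start (R : realType) (I J K p : nat)
    (w : blocks R I J K p) : Prop :=
  let: (X, Y, Z, _) := w in
  [/\ @unit_cols R I p X, @unit_cols R J p Y & @unit_cols R K p Z].

Definition LRAT_sequence (R : realType) (I J K p : nat) (A : tensor R I J K)
    (lambda s : R) (omega : nat -> blocks R I J K p) : Prop :=
  LRAT_start (omega 0%N) /\
  forall n, LRAT_step A lambda s (omega n) (omega n.+1).

(* Main.v *)
(* Each block update is a proximal step for the fidelity linearized at the old
   iterate: normalizing the columns projects onto the unit-column matrices, and
   soft thresholding is the proximal map of the l1 norm.  In each block the
   fidelity is a convex quadratic, so the minimality of the new iterate makes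
     (new gradient) - (old gradient) - t (new - old)
   a Frechet subgradient of Psi.  The quadratic part is dominated by the step
   constants (Cauchy-Schwarz), hence Psi decreases along the sequence; as the
   fidelity is nonnegative this bounds lambda * norm1 of the coefficients, while
   the factors are bounded by their unit columns.  On bounded sets the gradients,
   being polynomial, are Lipschitz and the step constants are bounded. *)

Require Import Defs.
From mathcomp Require Import all_boot all_order all_algebra.
From mathcomp Require Import all_classical all_reals all_analysis.
From mathcomp Require Import mxtens ring lra.

Set Implicit Arguments.
Unset Strict Implicit.
Unset Printing Implicit Defensive.
Import Order.TTheory GRing.Theory Num.Theory.
Import numFieldNormedType.Exports.

Local Open Scope classical_set_scope.
Local Open Scope ring_scope.

(** * Frobenius inner product and norm of matrices *)

Section InnerProduct.
Variables (R : realType) (m n : nat).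
Implicit Types (A B C : 'M[R]_(m, n)) (k : R).

Lemma inner_mxC A B : inner_mx A B = inner_mx B A.
Proof. by apply: eq_bigr => i _; apply: eq_bigr => j _; rewrite mulrC. Qed.

Lemma inner_mxDl A B C : inner_mx (A + B) C = inner_mx A C + inner_mx B C.
Proof.
rewrite -big_split; apply: eq_bigr => i _; rewrite -big_split.
by apply: eq_bigr => j _; rewrite mxE mulrDl.
Qed.

Lemma inner_mxZl k A C : inner_mx (k *: A) C = k * inner_mx A C.
Proof.
rewrite mulr_sumr; apply: eq_bigr => i _; rewrite mulr_sumr.
by apply: eq_bigr => j _; rewrite mxE mulrA.
Qed.

Lemma inner_mxNl A C : inner_mx (- A) C = - inner_mx A C.
Proof. by rewrite -scaleN1r inner_mxZl mulN1r. Qed.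

Lemma inner_mxBl A B C : inner_mx (A - B) C = inner_mx A C - inner_mx B C.
Proof. by rewrite inner_mxDl inner_mxNl. Qed.

Lemma inner_mxDr A B C : inner_mx A (B + C) = inner_mx A B + inner_mx A C.
Proof. by rewrite inner_mxC inner_mxDl !(inner_mxC A). Qed.

Lemma inner_mxZr k A C : inner_mx A (k *: C) = k * inner_mx A C.
Proof. by rewrite inner_mxC inner_mxZl inner_mxC. Qed.

Lemma inner_mxNr A C : inner_mx A (- C) = - inner_mx A C.
Proof. by rewrite inner_mxC inner_mxNl inner_mxC. Qed.

Lemma inner_mxBr A B C : inner_mx A (B - C) = inner_mx A B - inner_mx A C.
Proof. by rewrite inner_mxDr inner_mxNr. Qed.

Lemma inner_mx_ge0 A : 0 <= inner_mx A A.
Proof. by apply: sumr_ge0 => i _; apply: sumr_ge0 => j _; rewrite -expr2 sqr_ge0. Qed.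

Lemma inner_mx0l C : inner_mx 0 C = 0.
Proof. by rewrite -(scale0r 0) inner_mxZl mul0r. Qed.

Lemma inner_mx_suml (T : Type) (r : seq T) (F : T -> 'M[R]_(m, n)) C :
  inner_mx (\sum_(i <- r) F i) C = \sum_(i <- r) inner_mx (F i) C.
Proof.
exact: (big_morph (fun A => inner_mx A C) (fun A B => inner_mxDl A B C) (inner_mx0l C)).
Qed.

Lemma inner_mx_delta (i : 'I_m) (j : 'I_n) A : inner_mx (delta_mx i j) A = A i j.
Proof.
rewrite /inner_mx (bigD1 i) //= [X in X + _](bigD1 j) //= mxE !eqxx mul1r.
rewrite big1 => [|j' /negbTE nj]; last by rewrite mxE nj andbF mul0r.
rewrite big1 ?addr0 // => i' /negbTE ni; rewrite big1 // => j' _.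
by rewrite mxE ni mul0r.
Qed.

Lemma norm_F_sqr A : norm_F A ^+ 2 = inner_mx A A.
Proof.
rewrite sqr_sqrtr; first by do 2!apply: eq_bigr => ? _; rewrite expr2.
by apply: sumr_ge0 => i _; apply: sumr_ge0 => j _; rewrite sqr_ge0.
Qed.

Lemma norm_F_ge0 A : 0 <= norm_F A.
Proof. exact: sqrtr_ge0. Qed.

Lemma norm_F_eq0 A : (norm_F A == 0) = (A == 0).
Proof.
apply/eqP/eqP => [h|->]; last first.
  by apply/eqP; rewrite -sqrf_eq0 norm_F_sqr inner_mx0l.
have /eqP : inner_mx A A = 0 by rewrite -norm_F_sqr h expr0n.
have ge0 i : true -> 0 <= \sum_j A i j * A i j.
  by move=> _; apply: sumr_ge0 => j _; rewrite -expr2 sqr_ge0.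
rewrite psumr_eq0 // => /allP Ai; apply/matrixP => i j; rewrite mxE.
have /implyP/(_ isT) := Ai i (mem_index_enum _).
rewrite psumr_eq0 => [/allP Aij|j' _]; last by rewrite -expr2 sqr_ge0.
by have /implyP/(_ isT) := Aij j (mem_index_enum _); rewrite -expr2 sqrf_eq0 => /eqP.
Qed.

Lemma inner_mx_le A B : inner_mx A B <= norm_F A * norm_F B.
Proof.
have [->|B0] := eqVneq B 0.
  by rewrite inner_mxC inner_mx0l mulr_ge0 ?norm_F_ge0.
have nB : 0 < norm_F B by rewrite lt_neqAle norm_F_ge0 eq_sym norm_F_eq0 B0.
suff: (inner_mx A B) ^+ 2 <= (norm_F A * norm_F B) ^+ 2.
  move=> h; apply: le_trans (ler_norm _) _.
  by rewrite -ler_sqr ?nnegrE ?mulr_ge0 ?norm_F_ge0 // real_normK ?num_real.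
(* With [a], [b], [x] the inner products of [A] with [A], [B] with [B] and [A] with [B], the squared
   norm of [b A - x B] is [b (a b - x^2)]. *)
have := inner_mx_ge0 (inner_mx B B *: A - inner_mx A B *: B).
rewrite !(inner_mxBl, inner_mxBr, inner_mxZl, inner_mxZr) (inner_mxC B A).
rewrite exprMn !norm_F_sqr.
have : 0 < inner_mx B B by rewrite -norm_F_sqr exprn_gt0.
move: (inner_mx A B) (inner_mx A A) (inner_mx B B) => x a b b0 h.
have {}h : 0 <= b * (a * b - x ^+ 2) by move: h; congr (_ <= _); ring.
by rewrite pmulr_rge0 // subr_ge0 in h.
Qed.

Lemma norm_F_le_sum A : norm_F A <= \sum_i \sum_j `|A i j|.
Proof.
rewrite -(ler_pXn2r (n := 2)) ?nnegrE ?norm_F_ge0 //; last first.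
  by apply: sumr_ge0 => i _; apply: sumr_ge0 => j _.
rewrite norm_F_sqr /inner_mx !pair_big /=.
under eq_bigr => ij _ do rewrite -expr2 -real_normK ?num_real //.
rewrite expr2 mulr_suml; apply: ler_sum => ij _.
rewrite expr2 ler_wpM2l // (bigD1 ij) //= lerDl; exact: sumr_ge0.
Qed.

Lemma ler_entry_norm_F A (i : 'I_m) (j : 'I_n) : `|A i j| <= norm_F A.
Proof.
rewrite -(ler_pXn2r (n := 2)) ?nnegrE ?norm_F_ge0 // real_normK ?num_real //.
rewrite norm_F_sqr /inner_mx (bigD1 i) //= (bigD1 j) //= -expr2 -addrA lerDl.
rewrite addr_ge0 ?sumr_ge0 // => i' _; rewrite -?expr2 ?sqr_ge0 // sumr_ge0 // => j' _.
by rewrite -expr2 sqr_ge0.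
Qed.

Lemma norm_F_scale k A : norm_F (k *: A) = `|k| * norm_F A.
Proof.
apply/eqP; rewrite -(eqrXn2 (n := 2)) ?norm_F_ge0 ?mulr_ge0 ?norm_F_ge0 //.
by rewrite exprMn !norm_F_sqr inner_mxZl inner_mxZr real_normK ?num_real // expr2 mulrA.
Qed.

Lemma norm_F_leB A B : norm_F (A - B) <= norm_F A + norm_F B.
Proof.
rewrite -(ler_pXn2r (n := 2)) ?nnegrE ?addr_ge0 ?norm_F_ge0 //.
rewrite sqrrD !norm_F_sqr !(inner_mxBl, inner_mxBr) (inner_mxC B A).
have := inner_mx_le A (- B); rewrite inner_mxNr -(scaleN1r B) norm_F_scale.
rewrite normrN1 mul1r; lra.
Qed.

Lemma inner_mx_col A B : inner_mx A B = \sum_l inner_mx (col l A) (col l B).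
Proof.
rewrite /inner_mx exchange_big; apply: eq_bigr => l _.
by apply: eq_bigr => i _; rewrite big_ord1 !mxE.
Qed.

End InnerProduct.

(** * Subgradients from quadratic lower bounds *)

Section ProximalSubgradient.
Variables (R : realType) (m n : nat).
Implicit Types (x u : 'M[R]_(m, n)) (h : 'M[R]_(m, n) -> \bar R).

(** Links the neighbourhood filter, which comes from the sup norm, to the Frobenius norm: the latter
    is at most the sum of the [m * n] absolute entries. *)
Lemma norm_F_cvg0 x (e : R) : 0 < e -> \forall y \near x, norm_F (y - x) < e.
Proof.
(* Adding 1 keeps the divisor positive for empty matrices; the factor 2 in [e / (2 * k)] leaves room
   for a strict inequality. *)
move=> e0; pose k : R := (m * n)%:R + 1.
have k0 : 0 < k by rewrite ltr_wpDl.
near=> y.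
have yx : `|y - x| <= e / (2 * k).
  by rewrite distrC; near: y; apply: cvgr_dist_le; rewrite // divr_gt0 // mulr_gt0.
apply: le_lt_trans (norm_F_le_sum _) _.
apply: (@le_lt_trans _ _ (\sum_(i < m) \sum_(j < n) e / (2 * k))).
  do 2!(apply: ler_sum => ? _); apply: le_trans yx.
  rewrite /Num.norm /= mx_normrE; exact: (le_bigmax _ _ (_, _)).
rewrite !sumr_const !card_ord.
have -> : e / (2 * k) *+ n *+ m = e * ((m * n)%:R / k / 2).
  by rewrite -!(mulr_natr (_ / _ *+ _)) -(mulr_natr (_ / _)) natrM; field; rewrite gt_eqF.
rewrite gtr_pMr // ltr_pdivrMr // mul1r.
apply: (@le_lt_trans _ _ 1); last by rewrite ltr1n.
by rewrite ler_pdivrMr // mul1r lerDl.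
Unshelve. all: by end_near. Qed.

(** After division by [norm_F (y - x)] the quadratic defect is [C * norm_F (y - x)], which tends to
    0. No convexity of [h] is involved, and [h] may be infinite away from [x]. *)
Lemma frechet_subdiff_quadratic h x u (C : R) : h x \is a fin_num -> 0 <= C ->
  (forall y, (h x + (inner_mx u (y - x) - C * norm_F (y - x) ^+ 2)%:E <= h y)%E) ->
  frechet_subdiff h x u.
Proof.
move=> hx C0 hC; split => //; rewrite limf_einfE.
apply/lee_addgt0Pr => e e0; rewrite -leeBlDr ?sub0e; last by [].
(* On this punctured neighbourhood the difference quotient is at least [- e]. Radius [e / (C + 1)]
   suffices, also when [C = 0]. *)
pose V := [set y | y != x /\ C * norm_F (y - x) <= e].
have xV : x^' V.
  have C1 : 0 < C + 1 by rewrite ltr_wpDl.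
  have : \forall y \near x, norm_F (y - x) < e / (C + 1).
    by apply: norm_F_cvg0; rewrite divr_gt0.
  rewrite /dnbhs /within /=; apply: filterS => y yx yneq; split => //.
  move: yx; rewrite ltr_pdivlMr // => /ltW; apply: le_trans.
  by rewrite mulrDr mulr1 mulrC lerDl norm_F_ge0.
apply: le_trans (ereal_sup_ubound _); last by exists V; [exact: xV|reflexivity].
apply: le_ereal_inf_tmp => _ [y [yx Cy] <-].
have n0 : 0 < norm_F (y - x).
  by rewrite lt_neqAle norm_F_ge0 eq_sym norm_F_eq0 subr_eq0 yx.
apply: (@le_trans _ _ ((- C * norm_F (y - x) ^+ 2)%:E * (norm_F (y - x))^-1%:E)%E).
  rewrite -EFinM -EFinN lee_fin -mulrA expr2 mulfK ?gt_eqF // mulNr lerN2 //.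
apply: lee_wpmul2r; first by rewrite lee_fin invr_ge0 ltW.
have := hC y; case: (h x) hx => // a _.
case: (h y) => [b| |] //=; last by rewrite !addye ?leey.
by rewrite -!EFinD !lee_fin; lra.
Qed.

Lemma frechet_limiting_subdiff h x u :
  frechet_subdiff h x u -> limiting_subdiff h x u.
Proof.
move=> hu; split; first by case: hu.
by exists (fun=> x), (fun=> u); split => //; exact: cvg_cst.
Qed.

End ProximalSubgradient.

(** * Linear least squares and proximal steps *)

Section LeastSquares.
Variables (R : realType) (m n : nat) (E : finType) (B : E -> R).
Implicit Types (K : E -> 'M[R]_(m, n)) (S : set 'M[R]_(m, n)).
Implicit Types (g : 'M[R]_(m, n) -> R) (x y v : 'M[R]_(m, n)) (t d : R).

(** The common shape of the fidelity in each block: with the other blocks frozen, every entry of the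
    model tensor is a linear form in the free block, represented by a matrix [K e]. *)
Definition lsq K x : R := 2^-1 * \sum_e (B e - inner_mx x (K e)) ^+ 2.

Definition lsq_grad K x : 'M[R]_(m, n) :=
  \sum_e (inner_mx x (K e) - B e) *: K e.

(** The second-order Taylor formula is exact for a quadratic. It yields the gradient, the descent
    (bound the last term above) and the subgradient (bound it below by 0). *)
Lemma lsq_expand K x v : lsq K (x + v) =
  lsq K x + inner_mx (lsq_grad K x) v + 2^-1 * \sum_e inner_mx v (K e) ^+ 2.
Proof.
rewrite /lsq /lsq_grad inner_mx_suml.
have -> : \sum_e inner_mx ((inner_mx x (K e) - B e) *: K e) v =
  2^-1 * \sum_e 2 * ((inner_mx x (K e) - B e) * inner_mx v (K e)).
  rewrite mulr_sumr; apply: eq_bigr => e _.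
  by rewrite inner_mxZl (inner_mxC v) mulKf // pnatr_eq0.
rewrite -!mulrDr -!big_split /=; congr (_ * _); apply: eq_bigr => e _.
rewrite inner_mxDl; ring.
Qed.

Lemma grad_lsq K x : grad (lsq K) x = lsq_grad K x.
Proof.
apply/matrixP => i j; rewrite mxE /derive.
rewrite -[RHS](inner_mx_delta i j) inner_mxC; set v := delta_mx i j.
pose q := \sum_e inner_mx v (K e) ^+ 2.
apply/cvg_lim => //.
(* For [h != 0] the difference quotient is exactly affine in [h], with slope [q / 2]. *)
apply: (@cvg_trans _ ((inner_mx (lsq_grad K x) v + h * (2^-1 * q)) @[h --> (0 : R)^'])).
  apply: near_eq_cvg; near=> h.
  have h0 : h != 0 by near: h; exact: nbhs_dnbhs_neq.
  rewrite /= [_ + x]addrC lsq_expand inner_mxZr /q.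
  under [in RHS]eq_bigr => e _ do rewrite inner_mxZl exprMn.
  rewrite -mulr_sumr /GRing.scale /=; field.
  by rewrite h0.
move: (inner_mx _ v) => L.
have : (L + h * (2^-1 * q)) @[h --> (0 : R)] --> L + 0 * (2^-1 * q).
  by apply: cvgD; [exact: cvg_cst|apply: cvgMl; exact: cvg_id].
rewrite mul0r addr0; exact: cvg_within_filter.
Unshelve. all: by end_near. Qed.

(* x' minimizes over S the function g plus the linearization at x of a function
   with gradient gr there, plus t / 2 times the squared distance to x. *)
Definition prox_step S g t (gr x x' : 'M[R]_(m, n)) : Prop :=
  S x' /\ forall y, S y ->
    g x' + inner_mx gr (x' - x) + t / 2 * norm_F (x' - x) ^+ 2 <=
    g y + inner_mx gr (y - x) + t / 2 * norm_F (y - x) ^+ 2.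

(** Completing the square: [t / 2] times the squared distance to the gradient point [x - t^-1 *: gr]
    differs from the linearized model by [norm_F gr ^+ 2 / (2 t)], which does not depend on the
    competitor. *)
Lemma prox_step_dist S g t gr x x' : 0 < t -> S x' ->
  (forall y, S y -> g x' + t / 2 * norm_F (x' - (x - t^-1 *: gr)) ^+ 2 <=
                    g y + t / 2 * norm_F (y - (x - t^-1 *: gr)) ^+ 2) ->
  prox_step S g t gr x x'.
Proof.
move=> t0 Sx' h; split => // y /h.
have distE z : t / 2 * norm_F (z - (x - t^-1 *: gr)) ^+ 2 =
    inner_mx gr (z - x) + t / 2 * norm_F (z - x) ^+ 2
    + (2 * t)^-1 * norm_F gr ^+ 2.
  rewrite opprB addrCA addrC !norm_F_sqr.
  rewrite !(inner_mxDl (z - x)) !(inner_mxDr _ (z - x)) !(inner_mxZl, inner_mxZr).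
  rewrite (inner_mxC (z - x) gr); field; by rewrite gt_eqF.
rewrite !distE; lra.
Qed.

(** The old iterate is a competitor in the minimality of [x'], and [d <= t] makes the proximal term
    absorb the quadratic term of the expansion. *)
Lemma prox_step_descent S g t d K x x' :
  (forall v, \sum_e inner_mx v (K e) ^+ 2 <= d * norm_F v ^+ 2) -> d <= t ->
  S x -> prox_step S g t (lsq_grad K x) x x' ->
  lsq K x' + g x' <= lsq K x + g x.
Proof.
move=> hd dt Sx [_ /(_ _ Sx)].
rewrite subrr (inner_mxC _ 0) inner_mx0l (norm_F_sqr 0) inner_mx0l mulr0 !addr0 => h.
rewrite -{1}[x'](subrKC x) lsq_expand.
have := hd (x' - x); have : d * norm_F (x' - x) ^+ 2 <= t * norm_F (x' - x) ^+ 2.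
  by rewrite ler_wpM2r ?sqr_ge0.
lra.
Qed.

(** Minimality bounds [g y - g x'] below by a linear term minus [t / 2] times the squared distance
    from [x'] to [y]; convexity of [lsq K] supplies the other linear term. [gr] is not tied to [K],
    since the other blocks may change after the step is taken. *)
Lemma prox_step_subdiff S g t K gr x x' (h : 'M[R]_(m, n) -> \bar R) :
  0 <= t -> prox_step S g t gr x x' ->
  (forall y, S y -> h y = (lsq K y + g y)%:E) ->
  (forall y, ~ S y -> h y = +oo%E) ->
  limiting_subdiff h x' (lsq_grad K x' - gr - t *: (x' - x)).
Proof.
move=> t0 [Sx' hx'] hS hNS; apply: frechet_limiting_subdiff.
apply: (@frechet_subdiff_quadratic _ _ _ _ _ _ (t / 2)); rewrite ?hS ?divr_ge0 //.
move=> y; have [Sy|Sy] := pselect (S y); last by rewrite hNS ?leey.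
rewrite hS // -EFinD lee_fin.
have := hx' _ Sy; rewrite -[in lsq K y](subrKC x' y) lsq_expand.
have : 0 <= \sum_e inner_mx (y - x') (K e) ^+ 2.
  by apply: sumr_ge0 => e _; rewrite sqr_ge0.
(* Splitting at [x'] turns the difference of the two proximal terms into [t] times the inner product
   of [y - x'] and [x' - x], plus the quadratic defect in [y - x']. *)
have -> : y - x = (y - x') + (x' - x) by rewrite addrA subrK.
rewrite !norm_F_sqr; move: (y - x') (x' - x) => a b.
rewrite !(inner_mxDl, inner_mxDr, inner_mxNl, inner_mxZl) (inner_mxC a b).
lra.
Qed.

End LeastSquares.

(** * Column normalization and soft thresholding as proximal maps *)

Lemma normalize_colsE (R : realType) (m p : nat) (D : 'M[R]_(m, p)) l :
  col l (normalize_cols D) = (norm_F (col l D))^-1 *: col l D.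
Proof. by apply/colP => i; rewrite !mxE mulrC. Qed.

Lemma normalize_cols_unit (R : realType) (m p : nat) (D : 'M[R]_(m, p)) :
  (forall l, col l D != 0) -> unit_cols (normalize_cols D).
Proof.
move=> D0 l; rewrite normalize_colsE norm_F_scale normfV ger0_norm ?norm_F_ge0 //.
by rewrite mulVf // norm_F_eq0.
Qed.

Lemma unit_cols_norm (R : realType) (m p : nat) (X : 'M[R]_(m, p)) :
  unit_cols X -> inner_mx X X = p%:R.
Proof.
move=> X1; rewrite inner_mx_col (eq_bigr (fun=> 1)) => [|l _].
  by rewrite sumr_const card_ord.
by rewrite -norm_F_sqr X1 expr1n.
Qed.

(** All matrices with unit columns have the same Frobenius norm, so the nearest one to [D] is the
    one maximizing the inner product with [D]; Cauchy-Schwarz in each column shows that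
    normalization does this. *)
Lemma normalize_cols_prox (R : realType) (m p : nat) (t c : R) (gr X : 'M[R]_(m, p)) :
  0 < t -> (forall l, col l (X - t^-1 *: gr) != 0) ->
  prox_step (@unit_cols R m p) (fun=> c) t gr X
    (normalize_cols (X - t^-1 *: gr)).
Proof.
move=> t0 D0; apply: prox_step_dist => //; first exact: normalize_cols_unit.
move: D0; move: (X - t^-1 *: gr) => D D0 Y Y1; rewrite lerD2l ler_pM2l ?divr_gt0 //.
have X1 := normalize_cols_unit D0.
suff : inner_mx Y D <= inner_mx (normalize_cols D) D.
  rewrite !norm_F_sqr !(inner_mxBl, inner_mxBr) (unit_cols_norm Y1) (unit_cols_norm X1).
  rewrite !(inner_mxC D); lra.
rewrite (inner_mx_col Y) (inner_mx_col (normalize_cols D)); apply: ler_sum => l _.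
apply: le_trans (inner_mx_le _ _) _; rewrite Y1 mul1r normalize_colsE inner_mxZl.
by rewrite -norm_F_sqr expr2 mulKf // norm_F_eq0.
Qed.

Lemma soft_threshold_min (R : realType) (a b c lam t : R) : 0 < t -> 0 <= lam ->
  a = Num.sg b * Num.max (`|b| - lam / t) 0 ->
  lam * `|a| + t / 2 * (a - b) ^+ 2 <= lam * `|c| + t / 2 * (c - b) ^+ 2.
Proof.
move=> t0 l0; set r := lam / t => aE.
have r0 : 0 <= r by rewrite divr_ge0 // ltW.
have -> : lam = t * r by rewrite /r mulrCA divff ?gt_eqF ?mulr1.
suff h : r * `|a| + 2^-1 * (a - b) ^+ 2 <= r * `|c| + 2^-1 * (c - b) ^+ 2.
  have E z : t * r * `|z| + t / 2 * (z - b) ^+ 2 = t * (r * `|z| + 2^-1 * (z - b) ^+ 2).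
    by ring.
  by rewrite !E ler_wpM2l // ltW.
have bE : b = Num.sg b * `|b| by rewrite -numEsg.
have cs : - `|c| <= c <= `|c| by rewrite -ler_norml.
have rc z : - `|c| <= z <= `|c| -> - (r * `|c|) <= r * z <= r * `|c|.
  by move=> /andP[h1 h2]; rewrite -mulrN !ler_wpM2l.
(* If [|b| <= r] then [a = 0], and the claim reduces to [b c <= r |c| + c^2 / 2]. Otherwise
   [a = sgn b (|b| - r)]. *)
rewrite aE; have [br|br] := lerP (`|b| - r) 0; rewrite ?mulr0 ?normr0 ?mulr0.
  rewrite sub0r sqrrN add0r.
  have h : b * c <= r * `|c|.
    apply: le_trans (ler_norm _) _; rewrite normrM ler_wpM2r //; lra.
  have := sqr_ge0 c; nra.
have b0 : b != 0 by rewrite -normr_gt0; lra.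
have s2 : Num.sg b ^+ 2 = 1 by rewrite sqr_sg b0.
rewrite normrM normr_sg b0 mul1r (ger0_norm (ltW br)).
have -> : Num.sg b * (`|b| - r) - b = - (Num.sg b * r) by rewrite mulrBr -bE; ring.
rewrite sqrrN exprMn s2 mul1r.
have h : r * (Num.sg b * c) <= r * `|c|.
  rewrite ler_wpM2l //; apply: le_trans (ler_norm _) _.
  by rewrite normrM normr_sg b0 mul1r.
(* The square of [c - a], expanded, is twice the gap between the two objectives once [r |c|] is
   replaced by its lower bound [r (sgn b) c]. *)
have := sqr_ge0 (c - Num.sg b * (`|b| - r)).
have -> : (c - Num.sg b * (`|b| - r)) ^+ 2 = (c - b) ^+ 2 + 2 * r * (Num.sg b * c)
  - 2 * r * `|b| + r ^+ 2.
  have bb : `|b| = Num.sg b * b by rewrite -normrEsg.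
  have -> : Num.sg b * (`|b| - r) = b - Num.sg b * r by rewrite mulrBr -bE.
  rewrite bb; move: s2; move: (Num.sg b) => s s2.
  transitivity ((c - b) ^+ 2 + 2 * r * (s * c) - 2 * r * (s * b) + s ^+ 2 * r ^+ 2).
    by ring.
  by rewrite s2 mul1r.
lra.
Qed.

(** The objective is a sum over coordinates, so the scalar case applies to each one. *)
Lemma soft_threshold_prox (R : realType) (p : nat) (t lam : R) (gr a : 'rV[R]_p) :
  0 < t -> 0 <= lam ->
  prox_step setT (fun c => lam * norm1 c) t gr a
    (soft_threshold (lam / t) (a - t^-1 *: gr)).
Proof.
move=> t0 l0; apply: prox_step_dist => // c _; set b := a - _.
have E (z : 'rV[R]_p) : lam * norm1 z + t / 2 * norm_F (z - b) ^+ 2 =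
    \sum_l (lam * `|z 0 l| + t / 2 * (z 0 l - b 0 l) ^+ 2).
  rewrite norm_F_sqr /inner_mx big_ord1 /norm1 !mulr_sumr -big_split /=.
  by apply: eq_bigr => l _; rewrite !mxE expr2.
rewrite !E; apply: ler_sum => l _; rewrite [soft_threshold _ _ _ _]mxE.
by apply: soft_threshold_min; rewrite // mxE.
Qed.

(** * Step constants and the matrices defining them *)

Lemma norm_F_mulmx_le (R : realType) (m n q : nat) (H : 'M[R]_(m, n)) (M : 'M[R]_(n, q)) :
  norm_F (H *m M) ^+ 2 <= step_const M * norm_F H ^+ 2.
Proof.
apply: (@le_trans _ _ (norm_F (M *m M^T) * norm_F H ^+ 2)); last first.
  by rewrite ler_wpM2r ?sqr_ge0 // /step_const le_max lexx.
rewrite !norm_F_sqr /inner_mx [leRHS]mulr_sumr; apply: ler_sum => i _.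
(* The squared norm of row [i] of [H *m M] is the inner product of [M *m M^T] with the rank-one
   matrix [h], whose Frobenius norm is the squared norm of row [i] of [H]. *)
pose h := (row i H)^T *m row i H.
have hE l l' : h l l' = H i l * H i l' by rewrite !mxE big_ord1 !mxE.
have -> : \sum_j (H *m M) i j * (H *m M) i j = inner_mx (M *m M^T) h.
  transitivity (\sum_j \sum_l \sum_l' (H i l * M l j) * (H i l' * M l' j)).
    by apply: eq_bigr => j _; rewrite mxE big_distrlr.
  rewrite exchange_big; apply: eq_bigr => l _; rewrite exchange_big.
  apply: eq_bigr => l' _; rewrite hE mxE mulr_suml; apply: eq_bigr => j _.
  by rewrite [M^T _ _]mxE; ring.
apply: le_trans (inner_mx_le _ _) _; rewrite ler_wpM2l ?norm_F_ge0 //.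
have s0 : 0 <= \sum_j H i j * H i j.
  by apply: sumr_ge0 => j _; rewrite -expr2 sqr_ge0.
rewrite -(ler_pXn2r (n := 2)) ?nnegrE ?norm_F_ge0 //.
rewrite norm_F_sqr expr2 big_distrlr /= le_eqVlt; apply/orP; left; apply/eqP.
by apply: eq_bigr => l _; apply: eq_bigr => l' _; rewrite hE; ring.
Qed.

Lemma sum_mxtens (R : realType) (m n : nat) (F : 'I_(m * n) -> R) :
  \sum_q F q = \sum_i \sum_j F (mxtens_index (i, j)).
Proof.
rewrite pair_big /= (reindex (@mxtens_index m n)) /=.
  by apply: eq_bigr => -[].
by exists (@mxtens_unindex m n) => ? _; rewrite ?mxtens_indexK ?mxtens_unindexK.
Qed.

Lemma mat_krE (R : realType) (m n p : nat) (a : 'rV[R]_p) (B : 'M[R]_(m, p))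
    (C : 'M[R]_(n, p)) l i j :
  mat_kr a B C l (mxtens_index (i, j)) = a 0 l * (B i l * C j l).
Proof. by rewrite /mat_kr mul_diag_mx !mxE mxtens_indexK. Qed.

Lemma mat_QE (R : realType) (I J K p : nat) (X : 'M[R]_(I, p)) (Y : 'M[R]_(J, p))
    (Z : 'M[R]_(K, p)) l i j k :
  mat_Q X Y Z l (mxtens_index (mxtens_index (i, j), k)) = X i l * Y j l * Z k l.
Proof. by rewrite !mxE !mxtens_indexK ffunE !mxE. Qed.

(** * The fidelity as a least-squares function of each block *)

Section BlockKernels.
Variables (R : realType) (I J K p : nat) (A : tensor R I J K).
Implicit Types (X : 'M[R]_(I, p)) (Y : 'M[R]_(J, p)) (Z : 'M[R]_(K, p)).
Implicit Types (a : 'rV[R]_p) (e : 'I_I * 'I_J * 'I_K).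

(** Represents entry [e] of the model tensor as a linear form in the first factor. Only row [e.1.1]
    of that factor contributes, hence the indicator. The next three kernels do the same for the
    other blocks. *)
Definition kerX Y Z a e : 'M[R]_(I, p) :=
  \matrix_(i, l) ((i == e.1.1)%:R * (a 0 l * (Z e.2 l * Y e.1.2 l))).

Definition kerY X Z a e : 'M[R]_(J, p) :=
  \matrix_(j, l) ((j == e.1.2)%:R * (a 0 l * (Z e.2 l * X e.1.1 l))).

Definition kerZ X Y a e : 'M[R]_(K, p) :=
  \matrix_(k, l) ((k == e.2)%:R * (a 0 l * (Y e.1.2 l * X e.1.1 l))).

Definition ker_alpha X Y Z e : 'rV[R]_p :=
  \row_l (X e.1.1 l * Y e.1.2 l * Z e.2 l).

Lemma inner_mx_row (n : nat) (M : 'M[R]_(n, p)) (i0 : 'I_n) (c : 'I_p -> R) :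
  inner_mx M (\matrix_(i, l) ((i == i0)%:R * c l)) = \sum_l M i0 l * c l.
Proof.
rewrite /inner_mx (bigD1 i0) //= [X in _ + X]big1 ?addr0 => [|i /negbTE ni].
  by apply: eq_bigr => l _; rewrite mxE eqxx mul1r.
by rewrite big1 // => l _; rewrite mxE ni mul0r mulr0.
Qed.

Lemma fidelityE X Y Z a : fidelity A X Y Z a =
  2^-1 * \sum_e (A e - \sum_l a 0 l * (X e.1.1 l * Y e.1.2 l * Z e.2 l)) ^+ 2.
Proof.
rewrite /fidelity /tnorm_F sqr_sqrtr; last by apply: sumr_ge0 => e _; rewrite sqr_ge0.
congr (_ * _); apply: eq_bigr => e _; rewrite !ffunE /cp_sum sum_ffunE.
by congr ((_ - _) ^+ 2); apply: eq_bigr => l _; rewrite !ffunE !mxE.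
Qed.

Lemma fidelity_lsqX Y Z a : (fun X => fidelity A X Y Z a) = lsq A (kerX Y Z a).
Proof.
apply/funext => X; rewrite fidelityE; congr (_ * _); apply: eq_bigr => e _.
by rewrite inner_mx_row; congr ((_ - _) ^+ 2); apply: eq_bigr => l _; ring.
Qed.

Lemma fidelity_lsqY X Z a : (fun Y => fidelity A X Y Z a) = lsq A (kerY X Z a).
Proof.
apply/funext => Y; rewrite fidelityE; congr (_ * _); apply: eq_bigr => e _.
by rewrite inner_mx_row; congr ((_ - _) ^+ 2); apply: eq_bigr => l _; ring.
Qed.

Lemma fidelity_lsqZ X Y a : (fun Z => fidelity A X Y Z a) = lsq A (kerZ X Y a).
Proof.
apply/funext => Z; rewrite fidelityE; congr (_ * _); apply: eq_bigr => e _.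
by rewrite inner_mx_row; congr ((_ - _) ^+ 2); apply: eq_bigr => l _; ring.
Qed.

Lemma fidelity_lsq_alpha X Y Z :
  (fun a => fidelity A X Y Z a) = lsq A (ker_alpha X Y Z).
Proof.
apply/funext => a; rewrite fidelityE; congr (_ * _); apply: eq_bigr => e _.
by rewrite /inner_mx big_ord1; under [in RHS]eq_bigr do rewrite mxE.
Qed.

Lemma sum_entries (F : 'I_I * 'I_J * 'I_K -> R) :
  \sum_e F e = \sum_i \sum_j \sum_k F (i, j, k).
Proof. by rewrite !pair_big /=; apply: eq_bigr => -[[]]. Qed.

(** The left side is the squared Frobenius norm of [H *m mat_kr a Z Y]: tensor entries [(i, j, k)]
    match row [i] and column [(k, j)] of the product. The other blocks differ only in the order of
    summation. *)
Lemma kerX_le Y Z a (H : 'M[R]_(I, p)) :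
  \sum_e inner_mx H (kerX Y Z a e) ^+ 2 <= step_const (mat_kr a Z Y) * norm_F H ^+ 2.
Proof.
apply: le_trans (norm_F_mulmx_le _ _).
rewrite norm_F_sqr [leRHS]/inner_mx sum_entries; apply: ler_sum => i _.
rewrite sum_mxtens exchange_big; do 2!(apply: ler_sum => ? _).
rewrite inner_mx_row -expr2 mxE /=.
by under [in leRHS]eq_bigr do rewrite mat_krE.
Qed.

Lemma kerY_le X Z a (H : 'M[R]_(J, p)) :
  \sum_e inner_mx H (kerY X Z a e) ^+ 2 <= step_const (mat_kr a Z X) * norm_F H ^+ 2.
Proof.
apply: le_trans (norm_F_mulmx_le _ _).
rewrite norm_F_sqr [leRHS]/inner_mx sum_entries exchange_big; apply: ler_sum => j _.
rewrite sum_mxtens exchange_big; do 2!(apply: ler_sum => ? _).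
rewrite inner_mx_row -expr2 mxE /=.
by under [in leRHS]eq_bigr do rewrite mat_krE.
Qed.

Lemma kerZ_le X Y a (H : 'M[R]_(K, p)) :
  \sum_e inner_mx H (kerZ X Y a e) ^+ 2 <= step_const (mat_kr a Y X) * norm_F H ^+ 2.
Proof.
apply: le_trans (norm_F_mulmx_le _ _).
rewrite norm_F_sqr [leRHS]/inner_mx sum_entries.
under eq_bigr do rewrite exchange_big.
rewrite exchange_big; apply: ler_sum => k _.
rewrite sum_mxtens exchange_big; do 2!(apply: ler_sum => ? _).
rewrite inner_mx_row -expr2 mxE /=.
by under [in leRHS]eq_bigr do rewrite mat_krE.
Qed.

Lemma ker_alpha_le X Y Z (H : 'rV[R]_p) :
  \sum_e inner_mx H (ker_alpha X Y Z e) ^+ 2 <=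
  step_const (mat_Q X Y Z) * norm_F H ^+ 2.
Proof.
apply: le_trans (norm_F_mulmx_le _ _).
rewrite norm_F_sqr [leRHS]/inner_mx sum_entries big_ord1 !sum_mxtens.
do 3!(apply: ler_sum => ? _); rewrite /inner_mx big_ord1 -expr2 mxE /=.
by under [in leRHS]eq_bigr do rewrite mat_QE; under [in leLHS]eq_bigr do rewrite mxE.
Qed.

End BlockKernels.

(** * Bounded quantities with increments controlled by the step length *)

Section LipschitzPairs.
Variables (R : realType) (d : nat -> R).
Hypothesis d0 : forall n, 0 <= d n.
Implicit Types u v : nat -> R.

(* u and v are the values of a quantity after and before a step of length d.
   Products preserve this because it includes boundedness, so the gradients,
   whose entries are polynomials in the entries of the iterates, inherit it. *)
Definition lip_pair u v : Prop :=
  exists C, forall n, [/\ `|u n| <= C, `|v n| <= C & `|u n - v n| <= C * d n].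

Lemma lip_pair_ext u v u' v' : u =1 u' -> v =1 v' -> lip_pair u v -> lip_pair u' v'.
Proof. by move=> uu vv [C hC]; exists C => n; rewrite -uu -vv. Qed.

Lemma lip_pair_cst c : lip_pair (fun=> c) (fun=> c).
Proof. by exists `|c| => n; rewrite subrr normr0 mulr_ge0. Qed.

(** Blocks are updated in turn, so one already updated enters both gradients of a later block with
    its new value; this and its mirror image cover values used on both sides. *)
Lemma lip_pair_refl_l u v : lip_pair u v -> lip_pair u u.
Proof.
move=> [C hC]; exists C => n; have [uC _ _] := hC n.
by split=> //; rewrite subrr normr0 mulr_ge0 // (le_trans _ uC).
Qed.

Lemma lip_pair_refl_r u v : lip_pair u v -> lip_pair v v.
Proof.
by case=> C hC; apply: (@lip_pair_refl_l v u); exists C => n; rewrite distrC; case: (hC n).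
Qed.

Lemma lip_pairB u v u' v' : lip_pair u v -> lip_pair u' v' ->
  lip_pair (fun n => u n - u' n) (fun n => v n - v' n).
Proof.
move=> [C hC] [C' hC']; exists (C + C') => n.
have [h1 h2 h3] := hC n; have [h1' h2' h3'] := hC' n.
split; rewrite ?mulrDl; [| |rewrite opprD addrACA -opprD];
  by rewrite (le_trans (ler_normB _ _)) // lerD.
Qed.

Lemma lip_pairM u v u' v' : lip_pair u v -> lip_pair u' v' ->
  lip_pair (fun n => u n * u' n) (fun n => v n * v' n).
Proof.
(* One [C * C'] for each term of the split [u (u' - v') + (u - v) v']; the sum also bounds the
   products themselves. *)
move=> [C hC] [C' hC']; exists (C * C' + C * C') => n.
have [h1 h2 h3] := hC n; have [h1' h2' h3'] := hC' n.
have C0 : 0 <= C by rewrite (le_trans _ h1).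
have C0' : 0 <= C' by rewrite (le_trans _ h1').
have CC0 : 0 <= C * C' by rewrite mulr_ge0.
split; rewrite ?normrM.
- by rewrite (le_trans (ler_pM _ _ h1 h1')) // lerDl.
- by rewrite (le_trans (ler_pM _ _ h2 h2')) // lerDl.
have -> : u n * u' n - v n * v' n = u n * (u' n - v' n) + (u n - v n) * v' n.
  by ring.
rewrite (le_trans (ler_normD _ _)) // !normrM mulrDl lerD //.
  by rewrite -mulrA ler_pM.
by rewrite mulrAC ler_pM.
Qed.

Lemma lip_pair_abs u v : lip_pair u v -> lip_pair (fun n => `|u n|) (fun n => `|v n|).
Proof.
move=> [C hC]; exists C => n; have [h1 h2 h3] := hC n.
by rewrite !normr_id; split=> //; apply: le_trans (ler_dist_dist _ _) h3.
Qed.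

Lemma lip_pair_sum (T : finType) (u v : T -> nat -> R) :
  (forall i, lip_pair (u i) (v i)) ->
  lip_pair (fun n => \sum_i u i n) (fun n => \sum_i v i n).
Proof.
move=> /choice[C hC]; exists (\sum_i C i) => n; rewrite -sumrB mulr_suml.
by split; apply: le_trans (ler_norm_sum _ _ _) _; apply: ler_sum => i _;
  case: (hC i n).
Qed.

Section Matrices.
Variables (m n : nat).
Implicit Types x y : nat -> 'M[R]_(m, n).

Definition lip_mx x y : Prop :=
  forall i j, lip_pair (fun k => x k i j) (fun k => y k i j).

Lemma lip_mx_refl_l x y : lip_mx x y -> lip_mx x x.
Proof. by move=> h i j; apply: lip_pair_refl_l (h i j). Qed.

Lemma lip_mx_refl_r x y : lip_mx x y -> lip_mx y y.
Proof. by move=> h i j; apply: lip_pair_refl_r (h i j). Qed.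

Lemma lip_pair_inner x y x' y' : lip_mx x y -> lip_mx x' y' ->
  lip_pair (fun k => inner_mx (x k) (x' k)) (fun k => inner_mx (y k) (y' k)).
Proof.
by move=> h h'; do 2!apply: lip_pair_sum => ?; apply: lip_pairM; [exact: h|exact: h'].
Qed.

Lemma lip_mx_lsq_grad (E : finType) (B : E -> R) (K K' : nat -> E -> 'M[R]_(m, n)) x y :
  (forall e, lip_mx (K ^~ e) (K' ^~ e)) -> lip_mx x y ->
  lip_mx (fun k => lsq_grad B (K k) (x k)) (fun k => lsq_grad B (K' k) (y k)).
Proof.
move=> hK hx i j.
apply: (@lip_pair_ext (fun k => \sum_e (inner_mx (x k) (K k e) - B e) * K k e i j)
  (fun k => \sum_e (inner_mx (y k) (K' k e) - B e) * K' k e i j)).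
- by move=> k; rewrite summxE; apply: eq_bigr => e _; rewrite mxE.
- by move=> k; rewrite summxE; apply: eq_bigr => e _; rewrite mxE.
apply: lip_pair_sum => e; apply: lip_pairM; last exact: hK.
by apply: lip_pairB; [exact: lip_pair_inner|exact: lip_pair_cst].
Qed.

Lemma lip_mx_dist x y : lip_mx x y ->
  exists C, forall k, norm_F (x k - y k) <= C * d k.
Proof.
move=> h; pose P ij C := forall k, `|x k ij.1 ij.2 - y k ij.1 ij.2| <= C * d k.
have /choice[C hC] : forall ij : 'I_m * 'I_n, exists C, P ij C.
  by move=> -[i j]; have [C hC] := h i j; exists C => k; case: (hC k).
exists (\sum_ij C ij) => k; rewrite (le_trans (norm_F_le_sum _)) // pair_big /=.
by rewrite mulr_suml; apply: ler_sum => ij _; rewrite !mxE hC.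
Qed.

(** Only boundedness is needed. The Frobenius norm is not polynomial, so it is bounded through the
    sum of absolute entries; the maximum with 1 costs the added 1. *)
Lemma lip_mx_step_const x : lip_mx x x -> exists C, forall k, `|step_const (x k)| <= C.
Proof.
move=> h; have [C hC] : lip_pair (fun k => \sum_i \sum_i' `|(x k *m (x k)^T) i i'|)
    (fun k => \sum_i \sum_i' `|(x k *m (x k)^T) i i'|).
  do 2!apply: lip_pair_sum => ?; apply: lip_pair_abs; rewrite /mulmx.
  apply: (@lip_pair_ext _ _ _ _ _ _ (lip_pair_sum (fun j => lip_pairM (h _ j) (h _ j)))) => k;
    by rewrite mxE; apply: eq_bigr => j _; rewrite [in RHS]mxE.
exists (C + 1) => k; have [hk _ _] := hC k.
have C0 : 0 <= C by rewrite (le_trans _ hk).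
rewrite ger0_norm /step_const ?le_max ?ler01 ?orbT // ge_max lerDr C0 andbT.
apply: le_trans (norm_F_le_sum _) _; apply: le_trans (ler_norm _) _.
by rewrite (le_trans hk) // lerDl.
Qed.

End Matrices.

(** Bounds the subgradient produced by a proximal step: the gradient difference is Lipschitz in [d],
    and the displacement is multiplied by a bounded step constant. *)
Lemma prox_residual_le (m n : nat) (E : finType) (B : E -> R) (K K' : nat -> E -> 'M[R]_(m, n))
    (q r : nat) (s : R) (N : nat -> 'M[R]_(q, r)) x x' :
  (forall e, lip_mx (K' ^~ e) (K ^~ e)) -> lip_mx x' x -> lip_mx N N ->
  exists2 L, 0 < L & forall k,
    norm_F (lsq_grad B (K' k) (x' k) - lsq_grad B (K k) (x k)
            - (s * step_const (N k)) *: (x' k - x k)) <= L * d k.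
Proof.
move=> hK hx hN.
have [C1 hC1] := lip_mx_dist (lip_mx_lsq_grad B hK hx).
have [C2 hC2] := lip_mx_dist hx.
have [T hT] := lip_mx_step_const hN.
have T0 : 0 <= T by rewrite (le_trans _ (hT 0%N)).
(* The signs of [C1] and [C2] are unknown; the absolute value and the added 1 make the constant
   positive. *)
exists (`|C1 + `|s| * T * C2| + 1) => [|k]; first by rewrite ltr_wpDl.
apply: le_trans (norm_F_leB _ _) _; rewrite norm_F_scale normrM.
apply: (@le_trans _ _ ((C1 + `|s| * T * C2) * d k)); last first.
  by rewrite ler_wpM2r // (le_trans (ler_norm _)) // lerDl.
by rewrite mulrDl lerD // -!mulrA ler_wpM2l // ler_pM ?norm_F_ge0.
Qed.

End LipschitzPairs.

(** * Values of [Psi] on and off the constraint set *)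

Section Psi.
Variables (R : realType) (I J K p : nat) (A : tensor R I J K) (lambda : R).
Variables (X : 'M[R]_(I, p)) (Y : 'M[R]_(J, p)) (Z : 'M[R]_(K, p)) (a : 'rV[R]_p).

Lemma delta_in (T : Type) (S : set T) x : S x -> delta_ R S x = 0%E.
Proof. by move=> Sx; rewrite /delta_ mem_set. Qed.

Lemma Psi_fin : unit_cols X -> unit_cols Y -> unit_cols Z ->
  Psi A lambda (X, Y, Z, a) = (fidelity A X Y Z a + lambda * norm1 a)%:E.
Proof. by move=> hX hY hZ; rewrite /Psi !delta_in // !adde0. Qed.

Lemma Psi_infty : ~ (unit_cols X /\ unit_cols Y /\ unit_cols Z) ->
  Psi A lambda (X, Y, Z, a) = +oo%E.
Proof.
move=> h; rewrite /Psi /delta_.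
by case: ifPn => hX; case: ifPn => hY; case: ifPn => hZ //; case: h;
  rewrite !inE in hX hY hZ.
Qed.

End Psi.

(** * One iteration: proximal form, descent and subgradients *)

Section LRATStep.
Variables (R : realType) (I J K p : nat) (A : tensor R I J K) (lambda s : R).
Hypotheses (lambda_gt0 : 0 < lambda) (s_gt1 : 1 < s).
Variables (X X' : 'M[R]_(I, p)) (Y Y' : 'M[R]_(J, p)) (Z Z' : 'M[R]_(K, p)).
Variables (a a' : 'rV[R]_p).
Hypothesis step : LRAT_step A lambda s (X, Y, Z, a) (X', Y', Z', a').

Lemma step_const_gt0 (m n : nat) (M : 'M[R]_(m, n)) : 0 < step_const M.
Proof. by rewrite lt_max ltr01 orbT. Qed.

Lemma step_size_gt0 (m n : nat) (M : 'M[R]_(m, n)) : 0 < s * step_const M.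
Proof. by rewrite mulr_gt0 ?step_const_gt0 ?(lt_trans ltr01). Qed.

Lemma step_const_le (m n : nat) (M : 'M[R]_(m, n)) : step_const M <= s * step_const M.
Proof. by rewrite ler_peMl ?ltW ?step_const_gt0. Qed.

(** The l1 term is constant in a factor block. Leaving [c] free allows its value at the old
    coefficients for the descent and at the new ones for the subgradient. *)
Lemma LRAT_step_proxX c : prox_step (@unit_cols R I p) (fun=> c)
  (s * step_const (mat_kr a Z Y)) (lsq_grad A (kerX Y Z a) X) X X'.
Proof.
case: step => -[+ ->] _ _ _; rewrite fidelity_lsqX grad_lsq => D0.
exact: normalize_cols_prox (step_size_gt0 _) D0.
Qed.

Lemma LRAT_step_proxY c : prox_step (@unit_cols R J p) (fun=> c)
  (s * step_const (mat_kr a Z X')) (lsq_grad A (kerY X' Z a) Y) Y Y'.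
Proof.
case: step => _ [+ ->] _ _; rewrite fidelity_lsqY grad_lsq => D0.
exact: normalize_cols_prox (step_size_gt0 _) D0.
Qed.

Lemma LRAT_step_proxZ c : prox_step (@unit_cols R K p) (fun=> c)
  (s * step_const (mat_kr a Y' X')) (lsq_grad A (kerZ X' Y' a) Z) Z Z'.
Proof.
case: step => _ _ [+ ->] _; rewrite fidelity_lsqZ grad_lsq => D0.
exact: normalize_cols_prox (step_size_gt0 _) D0.
Qed.

Lemma LRAT_step_prox_alpha : prox_step setT (fun c => lambda * norm1 c)
  (s * step_const (mat_Q X' Y' Z')) (lsq_grad A (ker_alpha X' Y' Z') a) a a'.
Proof.
case: step => _ _ _ ->; rewrite fidelity_lsq_alpha grad_lsq.
exact: soft_threshold_prox (step_size_gt0 _) (ltW lambda_gt0).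
Qed.

(** Each block update decreases the objective with the others held at their current values, and the
    four inequalities chain. *)
Lemma LRAT_step_descent : unit_cols X -> unit_cols Y -> unit_cols Z ->
  fidelity A X' Y' Z' a' + lambda * norm1 a' <=
  fidelity A X Y Z a + lambda * norm1 a.
Proof.
move=> hX hY hZ.
have dX := prox_step_descent (kerX_le _ _ _) (step_const_le _) hX
  (LRAT_step_proxX (lambda * norm1 a)).
have dY := prox_step_descent (kerY_le _ _ _) (step_const_le _) hY
  (LRAT_step_proxY (lambda * norm1 a)).
have dZ := prox_step_descent (kerZ_le _ _ _) (step_const_le _) hZ
  (LRAT_step_proxZ (lambda * norm1 a)).
have da := prox_step_descent (@ker_alpha_le _ _ _ _ _ _ _ _) (step_const_le _) Logic.I
  LRAT_step_prox_alpha.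
rewrite -!fidelity_lsqX in dX; rewrite -!fidelity_lsqY in dY.
rewrite -!fidelity_lsqZ in dZ; rewrite -!fidelity_lsq_alpha in da.
exact: le_trans da (le_trans dZ (le_trans dY dX)).
Qed.

Lemma LRAT_step_unit : [/\ unit_cols X', unit_cols Y' & unit_cols Z'].
Proof.
by split; [case: (LRAT_step_proxX 0)|case: (LRAT_step_proxY 0)|case: (LRAT_step_proxZ 0)].
Qed.

(** The first gradient is taken with all blocks new, as [Psi] is considered at the new point; the
    second is the one the step used, with the remaining blocks still old. *)
Lemma LRAT_step_subdiffX : subdiff_X (Psi A lambda) (X', Y', Z', a')
  (lsq_grad A (kerX Y' Z' a') X' - lsq_grad A (kerX Y Z a) X
   - (s * step_const (mat_kr a Z Y)) *: (X' - X)).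
Proof.
have [hX hY hZ] := LRAT_step_unit.
apply: prox_step_subdiff (LRAT_step_proxX (lambda * norm1 a')) _ _ => [|M hM|M hM].
- exact: ltW (step_size_gt0 _).
- by rewrite Psi_fin // -fidelity_lsqX.
- by apply: Psi_infty => -[].
Qed.

Lemma LRAT_step_subdiffY : subdiff_Y (Psi A lambda) (X', Y', Z', a')
  (lsq_grad A (kerY X' Z' a') Y' - lsq_grad A (kerY X' Z a) Y
   - (s * step_const (mat_kr a Z X')) *: (Y' - Y)).
Proof.
have [hX hY hZ] := LRAT_step_unit.
apply: prox_step_subdiff (LRAT_step_proxY (lambda * norm1 a')) _ _ => [|M hM|M hM].
- exact: ltW (step_size_gt0 _).
- by rewrite Psi_fin // -fidelity_lsqY.
- by apply: Psi_infty => -[_ []].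
Qed.

Lemma LRAT_step_subdiffZ : subdiff_Z (Psi A lambda) (X', Y', Z', a')
  (lsq_grad A (kerZ X' Y' a') Z' - lsq_grad A (kerZ X' Y' a) Z
   - (s * step_const (mat_kr a Y' X')) *: (Z' - Z)).
Proof.
have [hX hY hZ] := LRAT_step_unit.
apply: prox_step_subdiff (LRAT_step_proxZ (lambda * norm1 a')) _ _ => [|M hM|M hM].
- exact: ltW (step_size_gt0 _).
- by rewrite Psi_fin // -fidelity_lsqZ.
- by apply: Psi_infty => -[_ []].
Qed.

Lemma LRAT_step_subdiff_alpha : subdiff_alpha (Psi A lambda) (X', Y', Z', a')
  (lsq_grad A (ker_alpha X' Y' Z') a' - lsq_grad A (ker_alpha X' Y' Z') a
   - (s * step_const (mat_Q X' Y' Z')) *: (a' - a)).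
Proof.
have [hX hY hZ] := LRAT_step_unit.
apply: prox_step_subdiff LRAT_step_prox_alpha _ _ => [|c _|c []//].
  exact: ltW (step_size_gt0 _).
by rewrite Psi_fin // -fidelity_lsq_alpha.
Qed.

End LRATStep.

(** * Lipschitz control of the kernels and step matrices *)

Section LipschitzKernels.
Variables (R : realType) (d : nat -> R).
Hypothesis d0 : forall n, 0 <= d n.
Variables (I J K p : nat).

Lemma lip_mx_mat_kr (m n : nat) (a a' : nat -> 'rV[R]_p)
    (B B' : nat -> 'M[R]_(m, p)) (C C' : nat -> 'M[R]_(n, p)) :
  lip_mx d a a' -> lip_mx d B B' -> lip_mx d C C' ->
  lip_mx d (fun k => mat_kr (a k) (B k) (C k)) (fun k => mat_kr (a' k) (B' k) (C' k)).
Proof.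
move=> ha hB hC l q; rewrite -[q]mxtens_unindexK; case: (mxtens_unindex q) => i j.
apply: (lip_pair_ext _ _ (lip_pairM (ha 0 l) (lip_pairM (hB i l) (hC j l)))) => k;
  by rewrite mat_krE.
Qed.

Lemma lip_mx_mat_Q (X X' : nat -> 'M[R]_(I, p)) (Y Y' : nat -> 'M[R]_(J, p))
    (Z Z' : nat -> 'M[R]_(K, p)) :
  lip_mx d X X' -> lip_mx d Y Y' -> lip_mx d Z Z' ->
  lip_mx d (fun n => mat_Q (X n) (Y n) (Z n)) (fun n => mat_Q (X' n) (Y' n) (Z' n)).
Proof.
move=> hX hY hZ l q; rewrite -[q]mxtens_unindexK; case: (mxtens_unindex q) => ij k.
rewrite -[ij]mxtens_unindexK; case: (mxtens_unindex ij) => i j.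
apply: (lip_pair_ext _ _ (lip_pairM (lip_pairM (hX i l) (hY j l)) (hZ k l))) => n;
  by rewrite mat_QE.
Qed.

Lemma lip_mx_kerX (Y Y' : nat -> 'M[R]_(J, p)) (Z Z' : nat -> 'M[R]_(K, p))
    (a a' : nat -> 'rV[R]_p) (e : 'I_I * 'I_J * 'I_K) :
  lip_mx d Y Y' -> lip_mx d Z Z' -> lip_mx d a a' ->
  lip_mx d (fun n => kerX (Y n) (Z n) (a n) e) (fun n => kerX (Y' n) (Z' n) (a' n) e).
Proof.
move=> hY hZ ha i l; apply: (lip_pair_ext _ _ (lip_pairM (lip_pair_cst d0 (i == e.1.1)%:R)
  (lip_pairM (ha 0 l) (lip_pairM (hZ e.2 l) (hY e.1.2 l))))) => n;
  by rewrite mxE.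
Qed.

Lemma lip_mx_kerY (X X' : nat -> 'M[R]_(I, p)) (Z Z' : nat -> 'M[R]_(K, p))
    (a a' : nat -> 'rV[R]_p) (e : 'I_I * 'I_J * 'I_K) :
  lip_mx d X X' -> lip_mx d Z Z' -> lip_mx d a a' ->
  lip_mx d (fun n => kerY (X n) (Z n) (a n) e) (fun n => kerY (X' n) (Z' n) (a' n) e).
Proof.
move=> hX hZ ha j l; apply: (lip_pair_ext _ _ (lip_pairM (lip_pair_cst d0 (j == e.1.2)%:R)
  (lip_pairM (ha 0 l) (lip_pairM (hZ e.2 l) (hX e.1.1 l))))) => n;
  by rewrite mxE.
Qed.

Lemma lip_mx_kerZ (X X' : nat -> 'M[R]_(I, p)) (Y Y' : nat -> 'M[R]_(J, p))
    (a a' : nat -> 'rV[R]_p) (e : 'I_I * 'I_J * 'I_K) :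
  lip_mx d X X' -> lip_mx d Y Y' -> lip_mx d a a' ->
  lip_mx d (fun n => kerZ (X n) (Y n) (a n) e) (fun n => kerZ (X' n) (Y' n) (a' n) e).
Proof.
move=> hX hY ha k l; apply: (lip_pair_ext _ _ (lip_pairM (lip_pair_cst d0 (k == e.2)%:R)
  (lip_pairM (ha 0 l) (lip_pairM (hY e.1.2 l) (hX e.1.1 l))))) => n;
  by rewrite mxE.
Qed.

Lemma lip_mx_ker_alpha (X X' : nat -> 'M[R]_(I, p)) (Y Y' : nat -> 'M[R]_(J, p))
    (Z Z' : nat -> 'M[R]_(K, p)) (e : 'I_I * 'I_J * 'I_K) :
  lip_mx d X X' -> lip_mx d Y Y' -> lip_mx d Z Z' ->
  lip_mx d (fun n => ker_alpha (X n) (Y n) (Z n) e)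
           (fun n => ker_alpha (X' n) (Y' n) (Z' n) e).
Proof.
move=> hX hY hZ i l; apply: (lip_pair_ext _ _ (lip_pairM (lip_pairM (hX e.1.1 l)
  (hY e.1.2 l)) (hZ e.2 l))) => n; by rewrite mxE.
Qed.

Lemma lip_mx_bounded (m n : nat) (x : nat -> 'M[R]_(m, n)) (C : R) :
  (forall k, norm_F (x k) <= C) -> (forall k, norm_F (x k.+1 - x k) <= d k) ->
  lip_mx d (fun k => x k.+1) x.
Proof.
(* [C] bounds the values, while 1 is the Lipschitz constant of an entry with respect to [d]. *)
move=> xC xd i j; exists (C + 1) => k.
have C0 : 0 <= C by rewrite (le_trans (norm_F_ge0 (x 0%N))).
split.
- by rewrite (le_trans (ler_entry_norm_F _ _ _)) // (le_trans (xC _)) // lerDl.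
- by rewrite (le_trans (ler_entry_norm_F _ _ _)) // (le_trans (xC _)) // lerDl.
have := ler_entry_norm_F (x k.+1 - x k) i j; rewrite !mxE => h.
by rewrite (le_trans h) // (le_trans (xd k)) // ler_peMl // lerDr.
Qed.

End LipschitzKernels.

(** * Boundedness of the iterates and the final constants *)

Lemma norm_F_blocks (R : realType) (I J K p : nat) (X : 'M[R]_(I, p))
    (Y : 'M[R]_(J, p)) (Z : 'M[R]_(K, p)) (a : 'rV[R]_p) :
  [/\ norm_F X <= norm_blocks (X, Y, Z, a), norm_F Y <= norm_blocks (X, Y, Z, a),
      norm_F Z <= norm_blocks (X, Y, Z, a) & norm_F a <= norm_blocks (X, Y, Z, a)].
Proof.
have h : 0 <= norm_F X ^+ 2 + norm_F Y ^+ 2 + norm_F Z ^+ 2 + norm_F a ^+ 2.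
  by rewrite !addr_ge0 ?sqr_ge0.
have hX := sqr_ge0 (norm_F X); have hY := sqr_ge0 (norm_F Y).
have hZ := sqr_ge0 (norm_F Z); have ha := sqr_ge0 (norm_F a).
by split; rewrite -(ler_pXn2r (n := 2)) ?nnegrE ?norm_F_ge0 ?sqrtr_ge0 // [leRHS]sqr_sqrtr //; lra.
Qed.

Theorem lemma4p5 (R : realType) (I J K p : nat) (A : tensor R I J K)
    (lambda s : R) (omega : nat -> blocks R I J K p)
    (hp : (0 < p)%N) (hrank : (tensor_rank A <= p)%N)
    (hlambda : 0 < lambda) (hs : 1 < s)
    (homega : LRAT_sequence A lambda s omega) :
  exists L1 L2 L3 L4 : R,
    [/\ 0 < L1, 0 < L2, 0 < L3 & 0 < L4] /\
    forall n : nat, (1 <= n)%N ->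
      [/\ exists2 eta1 : 'M[R]_(I, p), subdiff_X (Psi A lambda) (omega n) eta1
            & norm_F eta1 <= L1 * norm_blocks (omega n - omega n.-1),
          exists2 eta2 : 'M[R]_(J, p), subdiff_Y (Psi A lambda) (omega n) eta2
            & norm_F eta2 <= L2 * norm_blocks (omega n - omega n.-1),
          exists2 eta3 : 'M[R]_(K, p), subdiff_Z (Psi A lambda) (omega n) eta3
            & norm_F eta3 <= L3 * norm_blocks (omega n - omega n.-1)
        & exists2 eta4 : 'rV[R]_p, subdiff_alpha (Psi A lambda) (omega n) eta4
            & norm_F eta4 <= L4 * norm_blocks (omega n - omega n.-1)].
Proof.
case: homega => start step.
pose X n := (omega n).1.1.1; pose Y n := (omega n).1.1.2.
pose Z n := (omega n).1.2; pose a n := (omega n).2.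
have omegaE n : omega n = (X n, Y n, Z n, a n).
  by rewrite /X /Y /Z /a; case: (omega n) => -[[]].
have {}step n : LRAT_step A lambda s (X n, Y n, Z n, a n) (X n.+1, Y n.+1, Z n.+1, a n.+1).
  by rewrite -!omegaE.
(* [d n] is the length of the step from iterate [n] to iterate [n.+1]. *)
pose d n := norm_blocks (X n.+1 - X n, Y n.+1 - Y n, Z n.+1 - Z n, a n.+1 - a n).
have dE n : norm_blocks (omega n.+1 - omega n) = d n by rewrite !omegaE.
have d0 n : 0 <= d n by exact: sqrtr_ge0.
have d_ge n := norm_F_blocks (X n.+1 - X n) (Y n.+1 - Y n) (Z n.+1 - Z n) (a n.+1 - a n).
have unit n : [/\ unit_cols (X n), unit_cols (Y n) & unit_cols (Z n)].
  by case: n => [|n]; [move: start; rewrite omegaE|exact: LRAT_step_unit (step n)].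
pose Phi n := fidelity A (X n) (Y n) (Z n) (a n) + lambda * norm1 (a n).
have Phi_le n : Phi n <= Phi 0%N.
  elim: n => // n; apply: le_trans; have [hX hY hZ] := unit n.
  exact: LRAT_step_descent (step n) hX hY hZ.
(* The fidelity is nonnegative, so [lambda * norm1 (a n)] is at most [Phi 0]; the Frobenius norm of
   a row is at most its l1 norm. *)
have a_le n : norm_F (a n) <= Phi 0%N / lambda.
  rewrite ler_pdivlMr // mulrC; apply: le_trans (Phi_le n).
  apply: (@le_trans _ _ (lambda * norm1 (a n))).
    by rewrite ler_pM2l // (le_trans (norm_F_le_sum _)) // big_ord1.
  by rewrite lerDr mulr_ge0 ?invr_ge0 ?sqr_ge0.
have unit_le m (M : 'M[R]_(m, p)) : unit_cols M -> norm_F M <= Num.sqrt p%:R.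
  by move=> hM; rewrite -(unit_cols_norm hM) -norm_F_sqr sqrtr_sqr ler_norm.
have lX : lip_mx d (fun n => X n.+1) X.
  by apply: lip_mx_bounded => // n; [apply: unit_le; case: (unit n)|case: (d_ge n)].
have lY : lip_mx d (fun n => Y n.+1) Y.
  by apply: lip_mx_bounded => // n; [apply: unit_le; case: (unit n)|case: (d_ge n)].
have lZ : lip_mx d (fun n => Z n.+1) Z.
  by apply: lip_mx_bounded => // n; [apply: unit_le; case: (unit n)|case: (d_ge n)].
have la : lip_mx d (fun n => a n.+1) a.
  by apply: lip_mx_bounded => // n; case: (d_ge n).
(* The pairs from [lip_mx_refl_l] are new on both sides, for blocks updated earlier in the same
   iteration; those from [lip_mx_refl_r] are old on both sides, for the matrices in the step
   constants. *)
have lX' := lip_mx_refl_l d0 lX; have lY' := lip_mx_refl_l d0 lY.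
have lZ' := lip_mx_refl_l d0 lZ.
have rY := lip_mx_refl_r d0 lY; have rZ := lip_mx_refl_r d0 lZ.
have ra := lip_mx_refl_r d0 la.
have [L1 L1_gt0 hL1] := prox_residual_le d0 A s
  (fun e => lip_mx_kerX d0 e lY lZ la) lX (lip_mx_mat_kr ra rZ rY).
have [L2 L2_gt0 hL2] := prox_residual_le d0 A s
  (fun e => lip_mx_kerY d0 e lX' lZ la) lY (lip_mx_mat_kr ra rZ lX').
have [L3 L3_gt0 hL3] := prox_residual_le d0 A s
  (fun e => lip_mx_kerZ d0 e lX' lY' la) lZ (lip_mx_mat_kr ra lY' lX').
have [L4 L4_gt0 hL4] := prox_residual_le d0 A s
  (fun e => lip_mx_ker_alpha e lX' lY' lZ') la (lip_mx_mat_Q lX' lY' lZ').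
(* Writing the index as [n.+1] makes its predecessor [n], so the displacement is [d n]. *)
exists L1, L2, L3, L4; split=> // -[//|n] _; rewrite [n.+1.-1]/= !dE !omegaE.
split; eexists; [exact: LRAT_step_subdiffX (step n)|exact: hL1
  |exact: LRAT_step_subdiffY (step n)|exact: hL2
  |exact: LRAT_step_subdiffZ (step n)|exact: hL3
  |exact: LRAT_step_subdiff_alpha (step n)|exact: hL4].
Qed.
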